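(* Let $K$ be a virtual knot and let $\overline{K}$ be its mirror image. Then the odd writhe polynomials satisfy $$f_{\overline{K}}(t)=-f_K(t^{-1})\cdot t^2 .$$
   Context: All virtual knot diagrams are oriented. A virtual knot diagram is a planar 4-valent graph (the image of one immersed oriented closed curve) in which each vertex is either a real crossing (with over/under information) or a virtual crossing. A virtual knot is an equivalence class of such diagrams under generalized Reidemeister moves: the classical moves $\Omega_1,\Omega_2,\Omega_3$ (on real crossings), their virtual versions $\Omega_1',\Omega_2',\Omega_3'$ (all crossings virtual), and the semivirtual third move $\Omega_3^s$ (a strand with two consecutive virtual crossings passes across a real crossing). The Gauss diagram of a diagram $D$ is an anticlockwise oriented circle with one chord for each real crossing, joining the two preimages of the crossing. Each chord is oriented from the preimage of the overcrossing to the preimage of the undercrossing and carries the sign $w(c)\in\{+1,-1\}$ equal to the writhe of the crossing. Crossings and chords are denoted by the same letter $c$. The over-endpoint of $c$ is $c^+$ and the under-endpoint is $c^-$. A Gauss diagram determines its virtual knot uniquely. A chord $c$ (and the real crossing $c$) is odd if the number of endpoints of other chords lying on one (equivalently, on each) of the two open arcs of the circle bounded by $c^+$ and $c^-$ is odd; otherwise it is even. $Odd(D)$ is the set of odd crossings. If $D$ has $n$ real crossings, the $2n$ chord endpoints divide the circle into $2n$ arcs. For an arc $a$, choose a point in $a$ and travel once along the circle in its orientation; $N(a)$ is the sum of $w(c)$ over all chords $c$ for which $c^+$ is met before $c^-$. For a chord $c$ define $N(c)\in\mathbb{Z}$ as follows: if $w(c)=+1$, $N(c)=N(\text{arc immediately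 after }c^-)-N(\text{arc immediately after }c^+)$; if $w(c)=-1$, $N(c)=N(\text{arc immediately before }c^-)-N(\text{arc immediately before }c^+)$, where before/after refer to the orientation of the circle. The odd writhe polynomial of a virtual knot $K$ is $f_K(t)=\sum_{c\in Odd(D)}w(c)\,t^{N(c)}\in\mathbb{Z}[t,t^{-1}]$ for any diagram $D$ of $K$ (equal to $0$ if there are no odd crossings); it does not depend on the choice of $D$. The mirror image $\overline{K}$ of $K$ is the virtual knot obtained from $K$ by switching all real crossings (on Gauss diagrams: the direction of every chord is reversed and the sign of every chord is changed). *)

(* Defs.v *)
From HB Require Import structures.
From mathcomp Require Import all_boot all_order all_algebra.
From mathcomp Require Import generic_quotient boolp finmap monalg.
From Stdlib Require Import Relation_Operators.

Set Implicit Arguments.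
Unset Strict Implicit.
Unset Printing Implicit Defensive.

Import GRing.Theory.

(** ** Laurent polynomials with integer coefficients

    [{malg int[int]}] is the type of finitely supported functions [int -> int];
    [<< a *g n >>] is the monomial a t^n.  The library only makes [{malg R[M]}]
    a ring when no element of the monoid [M] but its unit is invertible, so the
    product of Z[t, t^-1] is set up here. *)

Section Laurent.
Local Open Scope fset_scope.
Local Open Scope ring_scope.

Definition laurent := {malg int[int]}.
HB.instance Definition _ := GRing.Zmodule.on laurent.

Implicit Types f g h : laurent.

Definition lone : laurent := << 1 *g 0 >>.

Definition lmul f g : laurent :=
  \sum_(k <- msupp f) \sum_(l <- msupp g) << f@_k * g@_l *g k + l >>.

Lemma lmulEw (d1 d2 : {fset int}) f g : msupp f `<=` d1 -> msupp g `<=` d2 ->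
  lmul f g = \sum_(k <- d1) \sum_(l <- d2) << f@_k * g@_l *g k + l >>.
Proof.
move=> le1 le2; rewrite /lmul.
rewrite (big_fset_incl _ le1) /=; last first.
  move=> k _ /mcoeff_outdom ->; rewrite big1 // => l _.
  by rewrite mul0r monalgU0.
apply: eq_bigr => k _; rewrite (big_fset_incl _ le2) //= => l _.
by move/mcoeff_outdom ->; rewrite mulr0 monalgU0.
Qed.

Lemma lmulC : commutative lmul.
Proof.
move=> f g; rewrite /lmul exchange_big /=.
by apply: eq_bigr => k _; apply: eq_bigr => l _; rewrite mulrC addrC.
Qed.

Lemma lmulDl : left_distributive lmul +%R.
Proof.
move=> f g h; set d := msupp f `|` msupp g `|` msupp (f + g).
have df : msupp f `<=` d by rewrite /d -fsetUA fsubsetUl.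
have dg : msupp g `<=` d by rewrite /d -fsetUA fsetUCA fsubsetUl.
have dfg : msupp (f + g) `<=` d by rewrite /d fsubsetUr.
rewrite (lmulEw dfg (fsubset_refl _)) (lmulEw df (fsubset_refl _)).
rewrite (lmulEw dg (fsubset_refl _)) -big_split /=; apply: eq_bigr => k _.
rewrite -big_split /=; apply: eq_bigr => l _.
by rewrite mcoeffD mulrDl monalgUD.
Qed.

Lemma lmulDr : right_distributive lmul +%R.
Proof. by move=> f g h; rewrite !(lmulC f) lmulDl. Qed.

Lemma lmul0l : left_zero 0 lmul.
Proof. by move=> f; apply: (@addIr _ (lmul 0 f)); rewrite -lmulDl !add0r. Qed.

Lemma lmul0r : right_zero 0 lmul.
Proof. by move=> f; rewrite lmulC lmul0l. Qed.

Lemma lmulUU (a b k l : int) :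
  lmul << a *g k >> << b *g l >> = << a * b *g k + l >>.
Proof.
by rewrite (lmulEw msuppU_le msuppU_le) !big_seq_fset1 !mcoeffUU.
Qed.

Lemma lind (P : laurent -> Prop) : P 0 -> (forall f g, P f -> P g -> P (f + g)) ->
  (forall a k, P << a *g k >>) -> forall f, P f.
Proof.
by move=> P0 PD PU f; rewrite (monalgE f); elim/big_ind: _ => // k _; apply: PU.
Qed.

Lemma lmulA : associative lmul.
Proof.
move=> f g h; elim/lind: f => [|f1 f2 e1 e2|a k].
- by rewrite (lmul0l g) !(lmul0l (lmul g h), lmul0l h).
- by rewrite (lmulDl f1 f2 g) (lmulDl f1) (lmulDl (lmul f1 g)) e1 e2.
elim/lind: g => [|g1 g2 e1 e2|b l].
- by rewrite (lmul0l h) (lmul0r << a *g k >>) (lmul0l h).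
- rewrite (lmulDl g1) (lmulDr _ (lmul g1 h)) (lmulDr _ g1).
  by rewrite (lmulDl (lmul _ g1)) e1 e2.
elim/lind: h => [|h1 h2 e1 e2|c m].
- by rewrite (lmul0r << b *g l >>) !lmul0r.
- by rewrite (lmulDr << b *g l >>) !(lmulDr _ _ h2) (lmulDr _ (lmul _ h1)) e1 e2.
by rewrite !lmulUU mulrA addrA.
Qed.

Lemma lmul1l : left_id lone lmul.
Proof.
move=> f; elim/lind: f => [|f g ef eg|a k]; rewrite ?lmul0r ?lmulDr ?ef ?eg //.
by rewrite lmulUU mul1r add0r.
Qed.

Lemma lone_neq0 : lone != 0.
Proof. by rewrite monalgU_eq0. Qed.

HB.instance Definition _ := GRing.Zmodule_isComNzRing.Build laurent
  lmulA lmulC lmul1l lmulDl lone_neq0.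

(** The variable t, and the substitution of t^-1 for t. *)
Definition lX : laurent := << 1 *g 1 >>.

Definition subst_inv f : laurent := \sum_(k <- msupp f) << f@_k *g - k >>.

End Laurent.

(** ** Virtual knot diagrams

    A diagram is a 4-valent graph in the plane (here: in the oriented sphere)
    that is the image of one closed oriented curve.  It is recorded by the
    cyclic word of the passages met along the curve.  A passage [p] is the
    traversal of a vertex by one of its two strands; it records
    - the name of the vertex;
    - whether the vertex is a virtual crossing or, if it is real, whether the
      strand being traversed is the upper or the lower one;
    - [r2l p]: whether the other strand crosses the one being traversed from
      its right to its left.
    The last bit gives the cyclic order of the four half-edges at each vertex,
    so the word determines a 4-valent graph embedded in a closed oriented
    surface; [planar] below says that this surface is the sphere. *)

Inductive level := Over | Under | Virtual.

Definition bool_of_level l :=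
  match l with Over => Some true | Under => Some false | Virtual => None end.
Definition level_of_bool b :=
  match b with Some true => Over | Some false => Under | None => Virtual end.
Lemma bool_of_levelK : cancel bool_of_level level_of_bool.
Proof. by case. Qed.
HB.instance Definition _ := Countable.copy level (can_type bool_of_levelK).

Record passage := Passage { vertex : nat; lev : level; r2l : bool }.

Definition tuple_of_passage p := (vertex p, lev p, r2l p).
Definition passage_of_tuple x :=
  let: (v, l, b) := x in Passage v l b.
Lemma tuple_of_passageK : cancel tuple_of_passage passage_of_tuple.
Proof. by case. Qed.
HB.instance Definition _ := Countable.copy passage (can_type tuple_of_passageK).

Definition switch_level l :=
  match l with Over => Under | Under => Over | Virtual => Virtual end.

(** The other passage through the same vertex. *)
Definition partner p := Passage (vertex p) (switch_level (lev p)) (~~ r2l p).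

Definition real p := lev p != Virtual.

Definition word := seq passage.

Implicit Types (p q r : passage) (w : word).

(** A side of an edge: [(p, true)] is the edge from [p] to the next passage,
    traversed forwards, [(p, false)] the edge from [p] to the previous passage,
    traversed backwards.  [face_next] follows such an edge to its end and turns
    left, so that its orbits are the boundaries of the faces. *)
Definition darts w : seq (passage * bool) :=
  [seq (p, b) | p <- w, b <- [:: true; false]].

Definition face_next w (d : passage * bool) : passage * bool :=
  let q := if d.2 then next w d.1 else prev w d.1 in
  (partner q, r2l q == d.2).

Definition face_rel w : rel (seq_sub (darts w)) :=
  fun d e => face_next w (val d) == val e.

(** Euler's formula V - E + F = 2, where 2 V = E = [size w].  The word [[::]]
    is the circle without crossings. *)
Definition planar w :=
  (w == [::]) || (n_comp (@face_rel w) predT == (size w)./2 + 2).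

Definition is_diagram w :=
  [&& uniq w, all (fun p => partner p \in w) w,
      all (fun p => count (fun q => vertex q == vertex p) w == 2) w
    & planar w].

Record diagram := Diagram { dword :> word; _ : is_diagram dword }.
HB.instance Definition _ := [isSub for dword].
HB.instance Definition _ := [Choice of diagram by <:].

(** ** Generalized Reidemeister moves *)

Definition rename (s : nat -> nat) p := Passage (s (vertex p)) (lev p) (r2l p).

(** In the third moves, [X], [Y] and [Z] are the three strands (two consecutive
    passages each); [p], [q] are the passages of [X], crossing [Y] and [Z], and
    [r] is the passage of [Y] crossing [Z].  The move reverses the order of the
    two crossings along each strand. *)
Definition three_strands p q r (X Y Z : word) :=
  [&& perm_eq X [:: p; q], perm_eq Y [:: partner p; r]
    & perm_eq Z [:: partner q; partner r]].

(** [left u]: at its passage [u], a strand has the triangle on its left, i.e.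
    either the other strand leaves [u] along the triangle and goes to the left,
    or it reaches [u] along the triangle and comes from the left.  The three
    segments bound a face when the two passages of each strand agree. *)
Definition triangle p q r (X Y Z : word) :=
  let firsts := [:: head p X; head p Y; head p Z] in
  let left u := (partner u \in firsts) == r2l u in
  [&& left p == left q, left (partner p) == left r
    & left (partner q) == left (partner r)].

(** Omega_3: three real crossings, [X] being above, or below, both other strands
    (there is a top and a bottom strand).
    Omega_3': three virtual crossings.
    Omega_3^s: one real crossing and a strand with two virtual crossings. *)
Variant third_move_levels p q r : Prop :=
  | Classical3 of real p & lev p = lev q & real r
  | Virtual3 of lev p = Virtual & lev q = Virtual & lev r = Virtual
  | Semivirtual3 of lev p = Virtual & lev q = Virtual & real r.

(** The first two constructors express that a diagram has neither a base point
    nor names for its vertices.  In [Move1] and [Move2] the crossings are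
    either all real or all virtual, as in Omega_1, Omega_2 and Omega_1',
    Omega_2'.  In [Move2] one strand is above, below or virtual at both
    crossings, and is crossed in opposite directions; the other strand runs
    parallel or antiparallel to it. *)
Inductive move : word -> word -> Prop :=
  | MoveBase k w : move w (rot k w)
  | MoveRename s w : injective s -> move w [seq rename s p | p <- w]
  | Move1 p w : move w [:: p, partner p & w]
  | Move2 p q Y w1 w2 :
      lev p = lev q -> r2l p != r2l q -> perm_eq Y [:: partner p; partner q] ->
      move (w1 ++ w2) ([:: p; q] ++ w1 ++ Y ++ w2)
  | Move3 p q r X Y Z w1 w2 w3 :
      three_strands p q r X Y Z -> triangle p q r X Y Z ->
      third_move_levels p q r ->
      move (X ++ w1 ++ Y ++ w2 ++ Z ++ w3)
           (rev X ++ w1 ++ rev Y ++ w2 ++ rev Z ++ w3).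

(** Both words of a move are required to be planar diagrams: in particular the
    strands of a bigon created by [Move2] lie on a common face. *)
Definition diagram_equiv : diagram -> diagram -> Prop :=
  clos_refl_sym_trans diagram (fun D D' => move D D').

Definition diagram_equivb (D D' : diagram) := `[< diagram_equiv D D' >].

Lemma diagram_equivb_refl : reflexive diagram_equivb.
Proof. by move=> D; apply/asboolP; apply: rst_refl. Qed.

Lemma diagram_equivb_sym : symmetric diagram_equivb.
Proof.
by move=> D D'; apply/asboolP/asboolP => ?; apply: rst_sym.
Qed.

Lemma diagram_equivb_trans : transitive diagram_equivb.
Proof.
by move=> D D' D'' /asboolP e /asboolP e'; apply/asboolP; apply: rst_trans e'.
Qed.

Canonical diagram_equivb_equiv :=
  EquivRel diagram_equivb diagram_equivb_refl diagram_equivb_sym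
    diagram_equivb_trans.

Definition virtual_knot := {eq_quot diagram_equivb}%qT.

(** ** Mirror image *)

(** Switching the two levels at a real crossing changes both the direction and
    the sign of its chord. *)
Definition switch p := Passage (vertex p) (switch_level (lev p)) (r2l p).

Lemma switchK : involutive switch.
Proof. by case=> v [] b. Qed.

Lemma partnerK : involutive partner.
Proof. by case=> v [] []. Qed.

Lemma partner_switch p : partner (switch p) = switch (partner p).
Proof. by []. Qed.

Lemma face_next_dart w d :
  all (fun p => partner p \in w) w -> d \in darts w -> face_next w d \in darts w.
Proof.
move=> /allP wP /allpairsP [[p b] /= [pw _ ->]].
apply/allpairsP; exists (face_next w (p, b)); split => //=.
  by apply: wP; case: b; rewrite ?mem_next ?mem_prev.
by case: (_ == _).
Qed.

Lemma face_next_inj w : uniq w -> injective (face_next w).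
Proof.
move=> Uw [p b] [q c] E; have /= /(can_inj partnerK) e := congr1 fst E.
have /= eb := congr1 snd E; clear E.
have ebc : b = c.
  by move: eb; rewrite e => {e}; move: (r2l _) => x; case: x b c => [] [] [].
move: e; rewrite -ebc; case: {c eb ebc} b.
  by move/(can_inj (prev_next Uw)) => ->.
by move/(can_inj (next_prev Uw)) => ->.
Qed.

Lemma face_rel_sym w : uniq w -> all (fun p => partner p \in w) w ->
  connect_sym (@face_rel w).
Proof.
move=> Uw wP.
pose f (d : seq_sub (darts w)) : seq_sub (darts w) :=
  SeqSub (face_next_dart wP (valP d)).
have fE : @face_rel w =2 frel f by move=> d e; rewrite /face_rel /= -val_eqE.
move=> d e; rewrite !(eq_connect fE); apply: fconnect_sym => {}d {}e.
by move/(congr1 val) => /= /(face_next_inj Uw) /val_inj.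
Qed.

Lemma planar_switch w : uniq w -> all (fun p => partner p \in w) w ->
  planar w -> planar (map switch w).
Proof.
move=> Uw wP; have injs := can_inj switchK.
have Usw : uniq (map switch w) by rewrite map_inj_uniq.
have swP : all (fun p => partner p \in map switch w) (map switch w).
  rewrite all_map; apply/allP => p pw /=.
  by rewrite partner_switch mem_map // (allP wP).
rewrite /planar size_map; case/orP => [/eqP -> //|/eqP <-].
apply/orP; right; apply/eqP.
have dP (d : seq_sub (darts w)) :
    (switch (val d).1, (val d).2) \in darts (map switch w).
  have /allpairsP [[p b] /= [pw bP ->]] := valP d.
  by apply/allpairsP; exists (switch p, b); split => //=; apply: map_f.
pose h d : seq_sub (darts (map switch w)) := SeqSub (dP d).
have face_switch d : face_next (map switch w) (switch d.1, d.2) =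
    (switch (face_next w d).1, (face_next w d).2).
  case: d => p b; rewrite /face_next /=.
  by case: b; rewrite ?(next_map injs) ?(prev_map injs).
apply: (adjunction_n_comp h) => //; do ?exact: face_rel_sym.
apply: strict_adjunction => //; do ?exact: face_rel_sym.
- move=> [[p b] pP] [[q c] qP] /(congr1 val) /= [e1 e2 e3] e4.
  by apply: val_inj => /=; congr (_, _) => //; apply: injs; rewrite /switch e1 e2 e3.
- apply/subsetP => -[[p b] pP] _.
  have /allpairsP [[p' c] /= [/mapP [q qw p'E] cP dE]] := pP.
  have qP : (q, c) \in darts w by apply/allpairsP; exists (q, c).
  by apply/codomP; exists (SeqSub qP); apply: val_inj; rewrite /= dE p'E.
- move=> d e _; rewrite /face_rel /= face_switch.
  case: (face_next w (val d)) (val e) => [p b] [q c] /=.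
  by rewrite !xpair_eqE (inj_eq injs).
Qed.

Lemma is_diagram_switch w : is_diagram w -> is_diagram (map switch w).
Proof.
case/and4P => Uw wP wV wG; apply/and4P; split.
- by rewrite map_inj_uniq //; exact: can_inj switchK.
- rewrite all_map; apply/allP => p pw /=.
  by rewrite partner_switch map_f // (allP wP).
- rewrite all_map; apply: sub_all wV => p /eqP <-.
  by rewrite /= count_map; apply/eqP/eq_count.
- exact: planar_switch.
Qed.

Definition mirror_diagram (D : diagram) : diagram :=
  let: Diagram w wP := D in Diagram (is_diagram_switch wP).

Lemma move_switch w w' : move w w' -> move (map switch w) (map switch w').
Proof.
have perm_switch (s t : word) : perm_eq s t -> perm_eq (map switch s) (map switch t).
  exact: perm_map.
case=> {w w'} [k w|s w injs|p w|p q Y w1 w2 lpq rpq YP|p q r X Y Z w1 w2 w3].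
- by rewrite map_rot; apply: MoveBase.
- have -> : map switch (map (rename s) w) = map (rename s) (map switch w).
    by rewrite -!map_comp.
  exact: MoveRename.
- exact: (Move1 (switch p)).
- rewrite !map_cat; apply: (Move2 (p := switch p) (q := switch q)) => //.
    by rewrite /= lpq.
  exact: perm_switch YP.
case/and3P => XP YP ZP tri levP; rewrite !map_cat !map_rev.
apply: (Move3 (p := switch p) (q := switch q) (r := switch r)).
- by rewrite /three_strands !partner_switch (perm_switch _ _ XP) (perm_switch _ _ YP)
    (perm_switch _ _ ZP).
- have hd S : head (switch p) (map switch S) = switch (head p S) by case: S.
  move: tri; rewrite /triangle !hd !partner_switch.
  by rewrite !inE !(inj_eq (can_inj switchK)).
- have rs x : real (switch x) = real x by case: x => v [] b.
  case: levP => [rp lpq rr|lp lq lr|lp lq rr].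
  + by apply: Classical3; rewrite ?rs //= lpq.
  + by apply: Virtual3; rewrite /= ?lp ?lq ?lr.
  + by apply: Semivirtual3; rewrite ?rs //= ?lp ?lq.
Qed.

Lemma mirror_diagram_equiv D D' :
  diagram_equiv D D' -> diagram_equiv (mirror_diagram D) (mirror_diagram D').
Proof.
elim=> {D D'} [[w wP] [w' wP'] m|D|D D' _ m|D D1 D2 _ m1 _ m2].
- by apply: rst_step; apply: move_switch m.
- exact: rst_refl.
- exact: rst_sym.
- exact: rst_trans m2.
Qed.

Definition mirror (K : virtual_knot) : virtual_knot :=
  \pi_virtual_knot%qT (mirror_diagram (repr K)).

Lemma pi_mirror D :
  mirror (\pi_virtual_knot%qT D) = \pi_virtual_knot%qT (mirror_diagram D).
Proof.
apply/(@eqmodP _ diagram_equivb_equiv)/asboolP/mirror_diagram_equiv/asboolP.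
by apply/(@eqmodP _ diagram_equivb_equiv); rewrite reprK.
Qed.

(** ** Odd writhe polynomial *)

(** The Gauss diagram, as a cyclic word read anticlockwise.  A chord [c] is
    designated by its over-endpoint c^+, its under-endpoint c^- is then
    [partner c]. *)
Definition gauss w : word := [seq p <- w | real p].

Definition chords (g : word) := [seq p <- g | lev p == Over].

(** A real crossing is positive when the lower strand crosses the upper one from
    its right to its left. *)
Definition writhe p : int := if (lev p == Over) == r2l p then 1%R else (-1)%R.

(** The endpoints met when travelling from c^+ to c^- are counted. *)
Definition odd_chord (g : word) p : bool :=
  odd (index (partner p) (rot (index p g) g)).-1.

Section OddWrithe.
Local Open Scope ring_scope.

(** N(a), where [a] is the arc that ends at the [i]-th endpoint; [rot i g] lists
    the endpoints in the order in which they are met from [a]. *)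
Definition N_arc (g : word) (i : nat) : int :=
  \sum_(c <- chords g | (index c (rot i g) < index (partner c) (rot i g))%N)
    writhe c.

Definition N_before g p := N_arc g (index p g).
Definition N_after g p := N_arc g (index p g).+1.

Definition N_chord g c : int :=
  if writhe c == 1 then N_after g (partner c) - N_after g c
  else N_before g (partner c) - N_before g c.

Definition diagram_poly (D : diagram) : laurent :=
  let g := gauss D in
  \sum_(c <- chords g | odd_chord g c) << writhe c *g N_chord g c >>.

(** [repr K] is some diagram of [K]; the value does not depend on it. *)
Definition odd_writhe_poly (K : virtual_knot) : laurent :=
  diagram_poly (repr K).

End OddWrithe.

(* Main.v *)
Require Import Defs.
From mathcomp Require Import all_boot all_algebra.
From mathcomp Require Import generic_quotient boolp finmap monalg zify ring.
From Stdlib Require Import Relation_Operators.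

Set Implicit Arguments.
Unset Strict Implicit.

Import GRing.Theory.

Local Open Scope ring_scope.

Implicit Types (p q r x y : passage) (w u v X Y Z : word).

(** The exponent [N_chord] has a closed form.  Moving the base arc across the
    over-endpoint of a chord [c] lowers [N_arc] by the writhe of [c], and moving
    it across the under-endpoint raises it by the same amount.  Both rules read:
    crossing a real passage [x] changes [N_arc] by [psign x], which is -1 or 1
    according to the side from which the other strand comes, so that the two
    endpoints of a chord have opposite signs.  Adding up the jumps, N(c) = 1 + I(c)
    for both signs of the chord ([N_chordE]), where I(c), called [span] below,
    is the sum of the signs strictly between c^+ and c^-.  Every sign is odd, so
    [c] is an odd chord exactly when I(c) is odd ([odd_chordE]).  Hence the
    polynomial is the sum of w(c) t^(1 + I(c)) over the chords with I(c) odd.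

    Mirror images: switching the levels preserves all signs and exchanges c^+
    with c^-.  As the signs of the whole word add up to 0, the complementary
    arc has sum -I(c), and the writhe is negated: w t^(1 + I) becomes
    - w t^(1 - I) = - w (t^-1)^(1 + I) t^2 ([span_poly_switch]).

    The polynomial of a knot is computed on a chosen representative, and the
    representative of the mirror image need not be the mirror image of the
    representative, so invariance of the polynomial under all moves is needed
    too ([span_poly_move]).  The spans make this elementary.  A first move adds
    a chord of span 0, which is even, and does not alter other spans.  A
    second move adds two chords with equal spans and opposite writhes, and the
    signs of each inserted pair cancel.  In a third move the two ends of each
    real chord are shifted past passages of equal signed weight: this is what
    the condition on the triangle says ([triangle_change]). *)

(** * Signs of passages, heights and spans *)

(** The jump of [N_arc] when its base arc passes [p]. *)
Definition psign p : int := if real p then (if r2l p then -1 else 1) else 0.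

Definition total w : int := \sum_(x <- w) psign x.

Definition height w p : int := total (take (index p w) w).

(** With [p] the over-endpoint of a chord, the sum of the signs on the open arc
    from [p] to [partner p].  The difference of heights gives it whichever end
    comes first in the word, because the total of a paired word is 0. *)
Definition span w p : int := height w (partner p) - height w p - psign p.

Lemma partnerI : injective partner.
Proof. exact: can_inj partnerK. Qed.

Lemma real_partner p : real (partner p) = real p.
Proof. by case: p => v [] b. Qed.

Lemma psign_partner p : psign (partner p) = - psign p.
Proof. by case: p => v [] []. Qed.

Lemma psign_over p : lev p = Over -> psign p = - writhe p.
Proof. by case: p => v [] []. Qed.

Lemma odd_psign p : odd (absz (psign p)) = real p.
Proof. by case: p => v [] []. Qed.

Lemma odd_abszD (a b : int) : odd (absz (a + b)) = odd (absz a) (+) odd (absz b).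
Proof. lia. Qed.

Lemma total_nil : total [::] = 0.
Proof. exact: big_nil. Qed.

Lemma total_cons x w : total (x :: w) = psign x + total w.
Proof. exact: big_cons. Qed.

Lemma total_cat u v : total (u ++ v) = total u + total v.
Proof. exact: big_cat. Qed.

Lemma total_perm u v : perm_eq u v -> total u = total v.
Proof. exact: perm_big. Qed.

Lemma odd_total w : odd (absz (total w)) = odd (count real w).
Proof.
elim: w => [|x w IHw]; first by rewrite total_nil.
by rewrite total_cons odd_abszD IHw odd_psign /= oddD; case: real.
Qed.

Lemma height_cons x w p :
  height (x :: w) p = if x == p then 0 else psign x + height w p.
Proof.
rewrite /height /=; case: eqP => _; first by rewrite total_nil.
exact: total_cons.
Qed.

Lemma height_cat u v p :
  height (u ++ v) p = if p \in u then height u p else total u + height v p.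
Proof.
elim: u => [|x u IHu] /=; first by rewrite total_nil add0r.
rewrite !height_cons inE eq_sym IHu total_cons; case: eqP => //= _.
by case: ifP; rewrite // addrA.
Qed.

Definition paired w := all (fun p => partner p \in w) w.

(** [partner] permutes the passages of a paired word; this makes the total vanish
    and exchanges sums over over-passages with sums over under-passages. *)
Lemma perm_partner w : uniq w -> paired w -> perm_eq (map partner w) w.
Proof.
move=> Uw /allP wP; apply: uniq_perm => //.
  by rewrite map_inj_uniq //; apply: partnerI.
move=> x; rewrite -{1}(partnerK x) (mem_map partnerI).
by apply/idP/idP => /wP //; rewrite partnerK.
Qed.

Lemma total_paired w : uniq w -> paired w -> total w = 0.
Proof.
move=> Uw wP; have := total_perm (perm_partner Uw wP).
rewrite {1}/total big_map; under eq_bigr do rewrite psign_partner.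
rewrite sumrN -/(total w); lia.
Qed.

Lemma span_partner w p : span w (partner p) = - span w p.
Proof. rewrite /span partnerK psign_partner; lia. Qed.

(** * The odd writhe polynomial in terms of spans *)

Definition chord_term w p : laurent :=
  if odd (absz (span w p)) then << writhe p *g span w p + 1 >> else 0.

Definition span_poly w : laurent := \sum_(p <- w | lev p == Over) chord_term w p.

Lemma under_partner x : real x -> lev x != Over -> lev (partner x) = Over.
Proof. by case: x => v [] b. Qed.

Lemma partner_neq p : partner p != p.
Proof. by case: p => v l []; apply/eqP. Qed.

(** The condition selecting the summands of [N_arc]. *)
Definition met_first (c : passage) z := (index c z < index (partner c) z)%N.

(** Moving the first endpoint [x] of the circle to the end only matters to the
    chord that ends at [x]: it stops being counted if [x] is its over-endpoint and
    starts being counted if [x] is its under-endpoint. *)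
Lemma met_first_rotate x t c : uniq (x :: t) ->
    c \in x :: t -> partner c \in x :: t -> lev c = Over ->
  (if met_first c (rcons t x) then writhe c else 0) =
  (if met_first c (x :: t) then writhe c else 0)
  + (if (c == x) || (partner c == x) then psign x else 0).
Proof.
move=> /=/andP [xt Ut]; rewrite /met_first -cats1 !index_cat /= !inE !(eq_sym x).
case: (eqVneq c x) => [cx _|cx] /=.
  rewrite -cx in xt *; rewrite (negbTE (partner_neq c)) /= => c't cO.
  rewrite c't (negbTE xt) psign_over // addrN addn0 ifN //.
  by rewrite -leqNgt index_size.
case: (eqVneq (partner c) x) => [c'x|c'x] /= ct; first last.
  by move=> c't _; rewrite ct c't addr0 ltnS.
move=> _ cO; rewrite ct -c'x psign_partner psign_over // opprK add0r c'x (negbTE xt).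
by rewrite addn0 index_mem ct.
Qed.

Section GaussWord.
Variable g : word.
Hypotheses (Ug : uniq g) (gP : paired g) (gR : all real g).

Let x0 := Passage 0 Over true.

Lemma N_arc_succ i : (i < size g)%N ->
  N_arc g i.+1 = N_arc g i + psign (nth x0 g i).
Proof.
move=> lti; set x := nth _ _ _.
have xg : x \in g by apply: mem_nth.
rewrite /N_arc rotS //.
(* The endpoint [x] is the one that passes from the front to the back. *)
have zE : rot i g = x :: behead (rot i g).
  by rewrite /rot (drop_nth x0).
have Uz : uniq (rot i g) by rewrite rot_uniq.
have zg : rot i g =i g by move=> y; rewrite mem_rot.
move: zE Uz zg; move: (rot i g) (behead _) => _ t -> Uz zg.
rewrite rot1_cons big_mkcond [X in _ = X + _]big_mkcond /=.
rewrite (eq_big_seq (fun c => (if met_first c (x :: t) then writhe c else 0)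
  + (if (c == x) || (partner c == x) then psign x else 0))); last first.
  move=> c; rewrite mem_filter => /andP [/eqP cO cg].
  by rewrite -met_first_rotate // zg // (allP gP).
rewrite big_split; congr (_ + _).
(* The over-endpoint of the chord ending at [x]. *)
pose d := if lev x == Over then x else partner x.
have dch : d \in chords g.
  rewrite mem_filter /d; case: ifP => [-> //|/negbT xO].
  by rewrite (allP gP) // (under_partner (allP gR _ xg) xO) eqxx.
have Uch : uniq (chords g) by apply: filter_uniq.
rewrite (eq_big_seq (fun c => if c == d then psign x else 0)).
  by rewrite (bigD1_seq d) //= eqxx big1 ?addr0 // => c /negbTE ->.
move=> c; rewrite mem_filter => /andP [/eqP cO cg].
congr (if _ then _ else _).
rewrite -(inj_eq partnerI (partner c)) partnerK /d.
case: ifP => /eqP xO; last first.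
  by rewrite (negbTE (_ : c != x)) //; apply/eqP => cx; rewrite cx in cO.
rewrite (negbTE (_ : c != partner x)) ?orbF //; apply/eqP => cx.
by move: cO; rewrite cx /= xO.
Qed.

Lemma N_arcE i : (i <= size g)%N -> N_arc g i = N_arc g 0 + total (take i g).
Proof.
elim: i => [|i IHi] lti; first by rewrite take0 total_nil addr0.
rewrite N_arc_succ // IHi ?(ltnW lti) // (take_nth x0) // -cats1 total_cat.
by rewrite total_cons total_nil addr0 addrA.
Qed.

(** A positive chord is measured between the arcs after its endpoints, a negative one
    between the arcs before them.  The arcs enclose, besides the open arc from c^+ to
    c^-, the endpoint c^- in the first case and c^+ in the second; either has
    sign +1, whence the same correction in both cases. *)
Lemma N_chordE c : c \in chords g -> N_chord g c = span g c + 1.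
Proof.
rewrite mem_filter => /andP [/eqP cO cg].
have c'g : partner c \in g by apply: (allP gP).
have before x : x \in g -> N_before g x = N_arc g 0 + height g x.
  by move=> xg; rewrite /N_before N_arcE // ltnW // index_mem.
have after x : x \in g -> N_after g x = N_arc g 0 + height g x + psign x.
  move=> xg; rewrite /N_after N_arc_succ ?index_mem // nth_index //.
  by rewrite -before.
rewrite /N_chord !before // !after // /span psign_partner psign_over //.
by have [->|->] : writhe c = 1 \/ writhe c = -1;
  [rewrite /writhe; case: eqP; [left|right] | |]; rewrite /=; lia.
Qed.

Lemma odd_height p : p \in g -> odd (absz (height g p)) = odd (index p g).
Proof.
move=> pg; rewrite odd_total; congr odd.
have /eqP -> : count real (take (index p g) g) == size (take (index p g) g).
  by rewrite -all_count; apply/allP => x /mem_take/(allP gR).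
by rewrite size_takel // index_size.
Qed.

(** All endpoints are real, so the parities of the heights are those of positions.
    If c^- precedes c^+ in the word, the endpoints of the arc are counted across the
    end of the word, whose length is even. *)
Lemma odd_chordE c : c \in chords g -> odd_chord g c = odd (absz (span g c)).
Proof.
rewrite mem_filter => /andP [/eqP cO cg].
have c'g : partner c \in g by apply: (allP gP).
have evg : odd (size g) = false.
  have /eqP <- : count real g == size g by rewrite -all_count.
  by rewrite -odd_total total_paired.
have -> : odd (absz (span g c)) = odd (index (partner c) g) (+) odd (index c g) (+) true.
  rewrite -!odd_height // /span.
  have := odd_psign c; rewrite (allP gR) //. lia.
rewrite /odd_chord rot_index //= (negbTE (_ : c != partner c)) /=; last first.
  by rewrite eq_sym partner_neq.
have := c'g; have := evg; have := Ug.
have gE : g = take (index c g) g ++ c :: drop (index c g).+1 g.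
  by rewrite -{1}(cat_take_drop (index c g) g) (drop_nth x0) ?index_mem ?nth_index.
have := size_takel (index_size c g).
move: gE; move: (take (index c g) g) (drop (index c g).+1 g) => u v gE szu.
have ic : index (partner c) g = if partner c \in u then index (partner c) u
    else (size u + (index (partner c) v).+1)%N.
  by rewrite {1}gE index_cat /= eq_sym (negbTE (partner_neq c)).
rewrite ic -szu {ic szu} gE index_cat size_cat mem_cat inE (negbTE (partner_neq c)) cat_uniq /=.
case/and3P => [_ /norP[_ /hasPn uv] _] ev.
case c'v : (partner c \in v).
  rewrite (negbTE (uv _ c'v)); lia.
rewrite orbF => ->; lia.
Qed.

End GaussWord.

(** Virtual passages have sign 0, so heights can be read off the whole word and
    the Gauss word need not be followed through the moves. *)
Lemma height_gauss w p : real p -> height (gauss w) p = height w p.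
Proof.
move=> pR; elim: w => [//|x w IHw].
rewrite height_cons -IHw /=; case: ifP => xR.
  by rewrite height_cons.
by rewrite /psign xR add0r ifN //; apply: contraFN xR => /eqP ->.
Qed.

Lemma span_gauss w p : real p -> span (gauss w) p = span w p.
Proof. by move=> pR; rewrite /span !height_gauss ?real_partner. Qed.

Lemma real_over p : lev p = Over -> real p.
Proof. by rewrite /real => ->. Qed.

Lemma diagramP (D : diagram) : uniq (dword D) /\ paired D.
Proof. by case: D => w /= /and4P []. Qed.

Lemma diagram_polyE (D : diagram) : diagram_poly D = span_poly D.
Proof.
have [UD DP] := diagramP D.
have Ug : uniq (gauss D) by rewrite filter_uniq.
have gP : paired (gauss D).
  apply/allP => p; rewrite !mem_filter real_partner => /andP [->] /=.
  by move=> pD; apply: (allP DP).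
have gR : all real (gauss D) by rewrite filter_all.
rewrite /diagram_poly /span_poly -[RHS]big_filter.
have -> : [seq p <- dword D | lev p == Over] = chords (gauss D).
  rewrite /chords -filter_predI; apply: eq_filter => p /=.
  by rewrite andb_idr // => /eqP/real_over.
rewrite big_mkcond; apply: eq_big_seq => c cg.
rewrite (odd_chordE Ug gP gR cg) (N_chordE Ug gP gR cg) span_gauss //.
by move: cg; rewrite mem_filter => /andP [/eqP/real_over].
Qed.

(** * Invariance under the moves *)

Lemma eq_span_poly u v : perm_eq u v ->
  {in u, forall p, lev p = Over -> span u p = span v p} ->
  span_poly u = span_poly v.
Proof.
move=> uv eq_sp; rewrite /span_poly -(perm_big _ uv) /= big_seq_cond.
rewrite [RHS]big_seq_cond; apply: eq_bigr => p /andP [pu /eqP pO].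
by rewrite /chord_term eq_sp.
Qed.

(** Changing the base point shifts heights by a constant, up to the total, which
    is 0. *)
Lemma span_catC u v p : uniq (u ++ v) -> paired (u ++ v) -> p \in u ++ v ->
  span (v ++ u) p = span (u ++ v) p.
Proof.
move=> Uw wP pw; have p'w := allP wP _ pw.
have := total_paired Uw wP; rewrite /span !height_cat total_cat.
move: Uw; rewrite cat_uniq => /and3P [_ /hasPn uv _].
have dis x : x \in u ++ v -> (x \in v) = ~~ (x \in u).
  rewrite mem_cat; case xv : (x \in v); first by rewrite (negbTE (uv _ xv)).
  by rewrite orbF => ->.
by rewrite !dis //; case: (p \in u); case: (partner p \in u) => /=; lia.
Qed.

Lemma span_poly_rot k w : uniq w -> paired w -> span_poly (rot k w) = span_poly w.
Proof.
move=> Uw wP; apply: eq_span_poly; first by rewrite perm_rot.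
move=> p; rewrite mem_rot => pw _.
by rewrite /rot span_catC cat_take_drop.
Qed.

Lemma span_poly_rename s w : injective s -> span_poly (map (rename s) w) = span_poly w.
Proof.
move=> injs.
have injr : injective (rename s).
  by move=> [v l b] [v' l' b'] [/injs -> -> ->].
have hE p : height (map (rename s) w) (rename s p) = height w p.
  by rewrite /height index_map // -map_take /total big_map.
have spE p : span (map (rename s) w) (rename s p) = span w p.
  by rewrite /span -hE -(hE p).
rewrite /span_poly big_map; apply: eq_bigr => p _.
by rewrite /chord_term spE.
Qed.

Lemma span_poly_move1 p w : uniq [:: p, partner p & w] -> paired w ->
  span_poly [:: p, partner p & w] = span_poly w.
Proof.
move=> Uw wP; rewrite /span_poly !big_cons.
have span0 : span [:: p, partner p & w] p = 0.
  rewrite /span !height_cons eqxx (negbTE (_ : p != partner p)) ?eqxx.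
    by rewrite addr0 subr0 subrr.
  by rewrite eq_sym partner_neq.
have t0 : chord_term [:: p, partner p & w] p = 0 by rewrite /chord_term span0.
have t1 : chord_term [:: p, partner p & w] (partner p) = 0.
  by rewrite /chord_term span_partner span0.
rewrite t0 t1 !add0r !if_same big_seq_cond [RHS]big_seq_cond.
apply: eq_bigr => q /andP [qw _].
have hE x : x \in w -> height [:: p, partner p & w] x = height w x.
  move=> xw; move: Uw; rewrite /= inE negb_or => /and3P [/andP [_ pw] p'w _].
  rewrite !height_cons (negbTE (_ : p != x)); last by apply: contraNneq pw => ->.
  rewrite (negbTE (_ : partner p != x)); last by apply: contraNneq p'w => ->.
  by rewrite psign_partner addrA subrr add0r.
by rewrite /chord_term /span !hE // (allP wP).
Qed.

Lemma perm_eq2 (T : eqType) (a b : T) s :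
  perm_eq s [:: a; b] -> s = [:: a; b] \/ s = [:: b; a].
Proof.
move=> sab; have := perm_size sab.
case: s sab => [|c [|d [|]]] // cdab _.
have sing (c1 d1 : T) : perm_eq [:: c1] [:: d1] -> c1 = d1.
  by move/perm_mem/(_ c1); rewrite !inE eqxx => /esym/eqP.
have := perm_mem cdab c; rewrite !inE eqxx => /esym/orP [] /eqP cE; rewrite cE in cdab *.
  by left; move: cdab; rewrite perm_cons => /sing ->.
right; move: cdab; rewrite perm_sym -(perm_rcons a [:: b]) perm_cons.
by move/sing ->.
Qed.

Lemma psign_same p q : lev p = lev q -> r2l p != r2l q -> psign q = - psign p.
Proof. by case: p q => v [] [] [v' [] []]. Qed.

Lemma writhe_same p q : lev p = lev q -> r2l p != r2l q -> writhe q = - writhe p.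
Proof. by case: p q => v [] [] [v' [] []]. Qed.

Lemma writhe_partner p : real p -> writhe (partner p) = writhe p.
Proof. by case: p => v [] []. Qed.

(** The strand of [p] and [q] is on one level and is crossed in opposite
    directions, so the signs of [p] and [q] cancel, as do their writhes.  The spans of
    [p] and [q] agree both when the second strand is parallel to the first and
    when it is antiparallel. *)
Lemma span_poly_move2 p q Y w1 w2 : lev p = lev q -> r2l p != r2l q ->
    perm_eq Y [:: partner p; partner q] ->
    uniq ([:: p; q] ++ w1 ++ Y ++ w2) -> paired (w1 ++ w2) ->
  span_poly ([:: p; q] ++ w1 ++ Y ++ w2) = span_poly (w1 ++ w2).
Proof.
move=> lpq rpq YP; set w := _ ++ _ => Uw wP.
have spq := psign_same lpq rpq.
have wE : perm_eq w ([:: p; q; partner p; partner q] ++ (w1 ++ w2)).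
  rewrite -[X in perm_eq _ X]/([:: p; q] ++ [:: partner p; partner q] ++ (w1 ++ w2)).
  by rewrite /w perm_cat2l perm_catCA perm_cat2r.
have totY : total Y = 0.
  by rewrite (total_perm YP) !total_cons total_nil !psign_partner spq; ring.
have hE x : x \in w1 ++ w2 -> height w x = height (w1 ++ w2) x.
  move=> xw; have : x \notin [:: p; q; partner p; partner q].
    move: Uw; rewrite (perm_uniq wE) cat_uniq => /and3P [_ /hasPn Uw _].
    exact: Uw.
  rewrite !inE !negb_or => /and4P [xp xq xp' xq'].
  rewrite /w !height_cat /= !height_cons !inE (negbTE xp) (negbTE xq) /=.
  rewrite (perm_mem YP) !inE (negbTE xp') (negbTE xq') /= totY.
  rewrite !total_cons total_nil spq; case: ifP => _; ring.
have spanpq : span w q = span w p.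
  have : uniq [:: p; q; partner p; partner q].
    by move: Uw; rewrite (perm_uniq wE) cat_uniq => /and3P [].
  have [p'w1 q'w1] : partner p \notin w1 /\ partner q \notin w1.
    move: Uw; rewrite (perm_uniq wE) cat_uniq has_cat negb_or.
    case/and3P => [_ /andP[/hasPn h _] _].
    by split; apply/negP => /h; rewrite !inE eqxx ?orbT.
  rewrite /= !inE !negb_or andbT => /and3P [/and3P [pq pp' pq'] /andP[qp' qq'] p'q'].
  rewrite /span /w !height_cat /= !inE !eqxx /= orbT !height_cons eqxx.
  rewrite !(eq_sym (partner _)) !(negbTE pq, negbTE pp', negbTE pq', negbTE qp', negbTE qq').
  rewrite (negbTE p'w1) (negbTE q'w1) !(perm_mem YP) !inE !eqxx orbT /=.
  rewrite !total_cons total_nil spq.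
  case: (perm_eq2 YP) => ->; rewrite !height_cons !eqxx ?(eq_sym (partner q)) (negbTE p'q')
    ?psign_partner ?spq; ring.
rewrite /span_poly (perm_big _ wE) big_cat /=.
rewrite [X in X + _ = _](_ : _ = 0) ?add0r.
  rewrite big_seq_cond [RHS]big_seq_cond.
  apply: eq_bigr => x /andP [xw _].
  by rewrite /chord_term /span !hE // (allP wP).
rewrite !big_cons big_nil /=.
have cancel_terms a c : << a *g c >> + << - a *g c >> = 0 :> laurent.
  by rewrite monalgUN subrr.
have opp_term x y : span w y = span w x -> writhe y = - writhe x ->
    chord_term w x + chord_term w y = 0.
  rewrite /chord_term => -> ->; case: ifP => _; last exact: addr0.
  exact: cancel_terms.
move El : (lev p) => l; case: l El => lp; rewrite -lpq lp /= ?addr0 //.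
  by apply: opp_term; rewrite ?spanpq ?(writhe_same lpq rpq).
apply: opp_term; rewrite ?span_partner ?spanpq // !writhe_partner.
- exact: writhe_same.
- by rewrite /real lp.
- by rewrite /real -lpq lp.
Qed.

(** The effect on heights of reversing a segment in place. *)
Definition height_change X x := height (rev X) x - height X x.

(** Reversing a segment preserves its total, so only heights inside the segment
    change. *)
Lemma height_change_in X Y Z w1 w2 w3 x : uniq (X ++ w1 ++ Y ++ w2 ++ Z ++ w3) ->
  height (rev X ++ w1 ++ rev Y ++ w2 ++ rev Z ++ w3) x =
  height (X ++ w1 ++ Y ++ w2 ++ Z ++ w3) x
  + (if x \in X then height_change X x else 0)
  + (if x \in Y then height_change Y x else 0)
  + (if x \in Z then height_change Z x else 0).
Proof.
have total_rev u : total (rev u) = total u by apply/total_perm; rewrite perm_rev.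
rewrite !height_cat !mem_rev !total_rev /height_change => Uw.
have dis u v : uniq (u ++ v) -> x \in u -> x \notin v.
  by rewrite cat_uniq => /and3P [_ /hasPn uv _] xu; apply/negP => /uv; rewrite /= xu.
have U1 : uniq (w1 ++ Y ++ w2 ++ Z ++ w3) by move: Uw; rewrite cat_uniq => /and3P [].
have U2 : uniq (Y ++ w2 ++ Z ++ w3) by move: U1; rewrite cat_uniq => /and3P [].
have U3 : uniq (w2 ++ Z ++ w3) by move: U2; rewrite cat_uniq => /and3P [].
case xX : (x \in X).
  have := dis _ _ Uw xX; rewrite !mem_cat !negb_or => /and5P [_ xY _ xZ _].
  rewrite (negbTE xY) (negbTE xZ); ring.
case x1 : (x \in w1).
  have := dis _ _ U1 x1; rewrite !mem_cat !negb_or => /and4P [xY _ xZ _].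
  rewrite (negbTE xY) (negbTE xZ); ring.
case xY : (x \in Y).
  have := dis _ _ U2 xY; rewrite !mem_cat !negb_or => /and3P [_ xZ _].
  rewrite (negbTE xZ); ring.
case x2 : (x \in w2).
  have := dis _ _ U3 x2; rewrite !mem_cat !negb_or => /andP [xZ _].
  rewrite (negbTE xZ); ring.
by case xZ : (x \in Z); ring.
Qed.

(** In a segment of two passages, reversal changes the height of each by the sign
    of the other one, taken positively for the first passage and negatively for the
    second.  So, for three real crossings, each conclusion equates two signs up to the
    orders of the crossings on the strands.  As the signs are given by [r2l], the
    conclusion for a crossing is the [triangle] equality for the strand that does not
    pass through that crossing.
    In a semivirtual move the real crossing exchanges places with virtual
    ones only, which have sign 0. *)
Lemma triangle_change p q r X Y Z :
    uniq [:: p; q; partner p; r; partner q; partner r] ->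
    three_strands p q r X Y Z -> triangle p q r X Y Z ->
    third_move_levels p q r ->
  [/\ real p -> height_change X p = height_change Y (partner p),
      real q -> height_change X q = height_change Z (partner q)
    & real r -> height_change Y r = height_change Z (partner r)].
Proof.
move=> U /and3P [/perm_eq2 XE /perm_eq2 YE /perm_eq2 ZE] tri levP.
have neq x y : x != y -> ((x == y) = false) * ((y == x) = false).
  by move=> xy; rewrite (eq_sym y) (negbTE xy).
move: U; rewrite /= !inE !negb_or -!andbA.
case/and5P=> /neq n1 /neq n2 /neq n3 /neq n4 /and5P [/neq n5 /neq n6 /neq n7 /neq n8].
case/and5P=> /neq n9 /neq n10 /neq n11 /neq n12 /and4P [/neq n13 /neq n14 /neq n15 _].
have {}neq := (n1, n2, n3, n4, n5, n6, n7, n8, n9, n10, n11, n12, n13, n14, n15).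
clear n1 n2 n3 n4 n5 n6 n7 n8 n9 n10 n11 n12 n13 n14 n15.
have signE x : real x -> psign x = if r2l x then -1 else 1 by rewrite /psign => ->.
have sign0 x : lev x = Virtual -> psign x = 0 by rewrite /psign /real => ->.
have rv x : lev x = Virtual -> real x -> False by rewrite /real => ->.
have hc a b : a != b -> height_change [:: a; b] a = psign b.
  by move=> ab; rewrite /height_change /rev /= !height_cons !eqxx eq_sym (negbTE ab) addr0 subr0.
have hc' a b : a != b -> height_change [:: a; b] b = - psign a.
  by move=> ab; rewrite /height_change /rev /= !height_cons !eqxx (negbTE ab) addr0 sub0r.
case: levP => [rp lpq rr|lp lq lr|lp lq rr]; last 2 first.
- by split => /rv.
- split; [by move/(rv _ lp) | by move/(rv _ lq) |] => _.
  case: YE => ->; case: ZE => ->; rewrite ?hc ?hc' ?neq // !psign_partner !sign0 //.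
have rq : real q by rewrite /real -lpq.
move: tri; rewrite /triangle !partnerK.
case: XE => ->; case: YE => ->; case: ZE => ->;
  rewrite ?hc ?hc' ?neq // !inE !eqxx !neq /=;
  rewrite ?psign_partner !signE //;
  case: (r2l p); case: (r2l q); case: (r2l r) => //=.
Qed.

Lemma span_poly_move3 p q r X Y Z w1 w2 w3 :
    three_strands p q r X Y Z -> triangle p q r X Y Z ->
    third_move_levels p q r ->
    uniq (X ++ w1 ++ Y ++ w2 ++ Z ++ w3) ->
  span_poly (rev X ++ w1 ++ rev Y ++ w2 ++ rev Z ++ w3) =
  span_poly (X ++ w1 ++ Y ++ w2 ++ Z ++ w3).
Proof.
move=> st tri levP; set w := X ++ _; set w' := rev X ++ _ => Uw.
have UXYZ : uniq (X ++ Y ++ Z).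
  apply: subseq_uniq Uw; rewrite /w cat_subseq //.
  apply: subseq_trans (suffix_subseq w1 _); rewrite cat_subseq //.
  by apply: subseq_trans (suffix_subseq w2 _); apply: prefix_subseq.
have U6 : uniq [:: p; q; partner p; r; partner q; partner r].
  case/and3P: st => XP YP ZP.
  rewrite -(perm_uniq (_ : perm_eq (X ++ Y ++ Z) _)) //.
  exact: perm_cat XP (perm_cat YP ZP).
have := triangle_change U6 st tri levP.
case/and3P: st => XP YP ZP [cp cq cr].
have ww' : perm_eq w' w.
  by rewrite /w /w'; do !apply: perm_cat => //; rewrite perm_rev.
apply: eq_span_poly => // x _ /real_over xR.
pose change y := (if y \in X then height_change X y else 0)
  + (if y \in Y then height_change Y y else 0)
  + (if y \in Z then height_change Z y else 0).
have heightE y : height w' y = height w y + change y.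
  by rewrite /w' height_change_in // /change !addrA.
suff changeE : change (partner x) = change x by rewrite /span !heightE changeE; ring.
have disXYZ y : [/\ (y \in X) && (y \in Y) = false, (y \in X) && (y \in Z) = false
    & (y \in Y) && (y \in Z) = false].
  move: UXYZ; rewrite !cat_uniq has_cat negb_or.
  case/and3P => _ /andP [/hasPn YX /hasPn ZX] /and3P [_ /hasPn ZY _].
  by split; apply/negP => /andP [y1 y2]; [have := YX _ y2|have := ZX _ y2|have := ZY _ y2];
    rewrite /= y1.
have onX y : y \in X -> change y = height_change X y.
  rewrite /change => yX; have [] := disXYZ y; rewrite yX /= => -> -> _.
  by rewrite !addr0.
have onY y : y \in Y -> change y = height_change Y y.
  rewrite /change => yY; have [] := disXYZ y; rewrite yY /= andbT => -> _ ->.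
  by rewrite addr0 add0r.
have onZ y : y \in Z -> change y = height_change Z y.
  rewrite /change => yZ; have [] := disXYZ y; rewrite yZ /= !andbT => _ -> ->.
  by rewrite !add0r.
have [pX qX] : p \in X /\ q \in X by rewrite !(perm_mem XP) !inE !eqxx orbT.
have [pY rY] : partner p \in Y /\ r \in Y by rewrite !(perm_mem YP) !inE !eqxx orbT.
have [qZ rZ] : partner q \in Z /\ partner r \in Z.
  by rewrite !(perm_mem ZP) !inE !eqxx orbT.
have changep : real p -> change (partner p) = change p.
  by move=> pR; rewrite (onX _ pX) (onY _ pY) cp.
have changeq : real q -> change (partner q) = change q.
  by move=> qR; rewrite (onX _ qX) (onZ _ qZ) cq.
have changer : real r -> change (partner r) = change r.
  by move=> rR; rewrite (onY _ rY) (onZ _ rZ) cr.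
(* Either [x] is an endpoint of a crossing of the triangle, or neither [x] nor its
   partner lies on one of the three reversed segments. *)
have [xs|] := boolP (x \in [:: p; q; partner p; r; partner q; partner r]).
  by move: xs xR; rewrite !inE => /or4P [|||/or3P []] /eqP ->;
    rewrite ?real_partner ?partnerK => ?;
    rewrite ?(changep, changeq, changer).
rewrite !inE !negb_or => /and5P [/negPf xp /negPf xq /negPf xp' /negPf xr /andP[/negPf xq' /negPf xr']].
rewrite /change !(perm_mem XP, perm_mem YP, perm_mem ZP) !inE !(inv_eq partnerK).
by rewrite !partnerK !(xp, xq, xp', xr, xq', xr').
Qed.

Lemma span_poly_move w w' : move w w' -> is_diagram w -> is_diagram w' ->
  span_poly w' = span_poly w.
Proof.
case=> {w w'} [k w|s w injs|p w|p q Y w1 w2 lpq rpq YP|p q r X Y Z w1 w2 w3 st tri levP]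
  /and4P [Uw wP _ _] /and4P [Uw' wP' _ _].
- exact: span_poly_rot.
- exact: span_poly_rename.
- exact: span_poly_move1.
- exact: span_poly_move2.
- exact: (span_poly_move3 st).
Qed.

Lemma diagram_poly_equiv D D' : diagram_equiv D D' -> diagram_poly D = diagram_poly D'.
Proof.
rewrite !diagram_polyE.
elim=> {D D'} [[w wP] [w' wP'] /= m|D|D D' _ ->|D D1 D2 _ -> _ ->] //.
by rewrite (span_poly_move m).
Qed.

(** The value on a knot can be computed on any of its diagrams. *)
Lemma odd_writhe_poly_pi D :
  odd_writhe_poly (\pi_virtual_knot%qT D) = diagram_poly D.
Proof.
apply: diagram_poly_equiv; apply/asboolP.
by apply/(@eqmodP _ diagram_equivb_equiv); rewrite reprK.
Qed.

(** * Mirror images *)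

Lemma span_switch w p : span (map switch w) (switch p) = span w p.
Proof.
have switchI := can_inj switchK.
have psignE x : psign (switch x) = psign x by case: x => v [] b.
have hE x : height (map switch w) (switch x) = height w x.
  rewrite /height index_map // -map_take /total big_map.
  by apply: eq_bigr => y _.
by rewrite /span partner_switch !hE psignE.
Qed.

Lemma writhe_switch p : real p -> writhe (switch p) = - writhe p.
Proof. by case: p => v [] []. Qed.

Lemma subst_invEw (d : {fset int}) (f : laurent) : (msupp f `<=` d)%fset ->
  subst_inv f = \sum_(k <- d) << f@_k *g - k >>.
Proof.
move=> fd; rewrite /subst_inv (big_fset_incl _ fd) //= => k _ /mcoeff_outdom ->.
exact: monalgU0.
Qed.

Lemma subst_invD : {morph subst_inv : f g / f + g}.
Proof.
move=> f g; pose d := (msupp f `|` msupp g)%fset.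
rewrite (@subst_invEw d) ?msuppD_le // (@subst_invEw d f) ?fsubsetUl //.
rewrite (@subst_invEw d g) ?fsubsetUr // -big_split /=.
by apply: eq_bigr => k _; rewrite mcoeffD monalgUD.
Qed.

Lemma subst_inv0 : subst_inv 0 = 0.
Proof. by apply: (addrI (subst_inv 0)); rewrite -subst_invD !addr0. Qed.

Lemma subst_invU (a k : int) : subst_inv << a *g k >> = << a *g - k >>.
Proof.
rewrite (@subst_invEw [fset k]%fset) ?msuppU_le // big_seq_fset1.
by rewrite mcoeffUU.
Qed.

Lemma lX2E : lX ^+ 2 = << 1 *g 2 >> :> laurent.
Proof. by rewrite expr2 [LHS]lmulUU. Qed.

(** The chord with over-endpoint [p] has over-endpoint [switch (partner p)] in the
    mirror image, hence the reindexing along [partner]. *)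
Lemma span_poly_switch w : uniq w -> paired w ->
  span_poly (map switch w) = - subst_inv (span_poly w) * lX ^+ 2.
Proof.
move=> Uw wP; rewrite lX2E.
rewrite /span_poly big_map -(perm_big _ (perm_partner Uw wP)) big_map /=.
rewrite (big_morph _ subst_invD subst_inv0) -sumrN big_distrl /=.
apply: eq_big => [p|p]; first by case: p => v [] b.
move=> pO; have pR : real p by move: pO; case: p => v [] b.
rewrite /chord_term span_switch span_partner writhe_switch ?real_partner //.
rewrite writhe_partner // abszN; case: ifP => _; last first.
  by rewrite subst_inv0 oppr0 mul0r.
rewrite subst_invU -monalgUN [RHS]lmulUU mulr1; congr << _ *g _ >>; ring.
Qed.

Theorem proposition4p6 (K : virtual_knot) :
  odd_writhe_poly (mirror K) = - subst_inv (odd_writhe_poly K) * lX ^+ 2.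
Proof.
rewrite /mirror odd_writhe_poly_pi /odd_writhe_poly; move: (repr K) => D.
have [UD DP] := diagramP D.
rewrite !diagram_polyE -span_poly_switch //.
by case: D {UD DP}.
Qed.
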